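(* Let $n,t$ be positive integers with $n\le t<2n$, and let $T(t,n)$ be the number of distinct subsets $S\subseteq\{0,1\}^n$ such that $S=F_n(w)$ for some word $w\in\{0,1\}^t$. Then $$T(t,n) = 2^t-\sum_{k=1}^{t-n+1}\frac{k-1}{k}\sum_{d\mid k}\mu\!\left(\frac{k}{d}\right)2^d,$$ where $\mu(\cdot)$ is the M\''obius function.
   Context: For a word $w$, $F_n(w)$ denotes the set of all length-$n$ (contiguous) factors of $w$ in the ordinary, non-circular sense. *)

(* Defs.v *)
From mathcomp Require Import all_boot all_order all_algebra.

Set Implicit Arguments.
Unset Strict Implicit.
Unset Printing Implicit Defensive.

Import GRing.Theory.
Local Open Scope ring_scope.

(* [infix u w] means that [w = s ++ u ++ s'] for some [s] and [s'], so factors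
   do not wrap around the end of [w]. *)
Definition factors (A : finType) (n : nat) (w : seq A) : {set n.-tuple A} :=
  [set u : n.-tuple A | infix u w].

Definition num_factor_sets (t n : nat) : nat :=
  #|[set S : {set n.-tuple bool} |
      [exists w : t.-tuple bool, S == factors n w]]|.

Definition squarefree (n : nat) : bool :=
  (0 < n)%N && all (fun p => ~~ (p ^ 2 %| n)%N) (primes n).

(* The junk value at 0 is [mobius 0 = 0]. *)
Definition mobius (n : nat) : int :=
  if squarefree n then (-1) ^+ size (primes n) else 0.

(* Main.v *)
(* Write m = t - n + 1 <= n for the number of windows of a word of length t.
   Two distinct words with the same set of length-n factors both have a period
   p <= m, and then differ only by a cyclic shift of that period. Indeed, if
   the first n - 1 letters do not reappear in one of the words, both words must
   begin with the same window and one inducts on their tails; likewise at the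
   other end. If both ends reappear, the word is covered by two runs with
   periods p, q <= m overlapping in at least p + q - 1 letters, and Fine-Wilf
   applies.
   So a factor set is shared by exactly k words when their minimal period k is
   at most m, and by one word otherwise, and T(t, n) is the sum over words of
   the inverse class size. For k <= m the 2^k words of period k are, by Fine-
   Wilf, those whose minimal period divides k; Moebius inversion then counts
   the words with minimal period k. *)
Require Import Defs.
From mathcomp Require Import all_boot all_order all_algebra zify ring.

Set Implicit Arguments.
Unset Strict Implicit.
Unset Printing Implicit Defensive.

Import GRing.Theory Num.Theory.
Local Open Scope nat_scope.

Section Periods.
Variable T : eqType.
Implicit Types f g : nat -> T.

Definition has_period f p a b :=
  forall i j, a <= i < b -> a <= j < b -> i = j %[mod p] -> f i = f j.

Lemma has_periodP f p a b : 0 < p ->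
  (forall i, a <= i -> i + p < b -> f (i + p) = f i) <-> has_period f p a b.
Proof.
move=> p_gt0; split=> [step | per i le_ai lt_ipb]; last first.
  by apply: per; rewrite ?modnDr //; lia.
have mult k i : a <= i -> i + k * p < b -> f (i + k * p) = f i.
  elim: k => [|k IHk] le_ai lt_b; first by rewrite addn0.
  rewrite mulSn (addnC p) addnA step; [| lia | lia].
  by apply: IHk => //; lia.
suff le_case i j : i <= j -> a <= i -> j < b -> i = j %[mod p] -> f i = f j.
  move=> i j /andP[ai ib] /andP[aj jb] eq_ij.
  by case: (leqP i j) => [le|/ltnW le]; [|symmetry]; apply: le_case.
move=> le_ij le_ai lt_jb /esym/eqP; rewrite (eqn_mod_dvd p le_ij).
case/dvdnP=> k def_k; have def_j : j = i + k * p by lia.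
by rewrite def_j mult //; lia.
Qed.

Lemma residue_in_interval p c i : 0 < p ->
  exists2 j, c <= j < c + p & j = i %[mod p].
Proof.
move=> p_gt0; exists (c + (i + (p - c %% p)) %% p).
  by rewrite leq_addr ltn_add2l ltn_pmod.
rewrite modnDmr {1}(divn_eq c p).
have := ltn_pmod c p_gt0; set q := c %/ p; set r := c %% p => lt_rp.
have -> : q * p + r + (i + (p - r)) = (q.+1 * p + i) by nia.
by rewrite modnMDl.
Qed.

Lemma has_period_sub f p a b c d :
  a <= c -> d <= b -> has_period f p a b -> has_period f p c d.
Proof. by move=> le_ac le_db per i j ? ?; apply: per; lia. Qed.

Lemma has_period_extend f p q a b c d : 0 < p -> q %| p ->
  a <= c -> d <= b -> c + p <= d ->
  has_period f p a b -> has_period f q c d -> has_period f q a b.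
Proof.
move=> p_gt0 dvd_qp le_ac le_db le_cpd perp perq i j i_ab j_ab eq_ij.
have [i' i'_c eq_i] := residue_in_interval c i p_gt0.
have [j' j'_c eq_j] := residue_in_interval c j p_gt0.
have mod_q x y : x = y %[mod p] -> x = y %[mod q].
  by move=> e; rewrite -(modn_dvdm x dvd_qp) e modn_dvdm.
have sub_c x : c <= x < c + p -> c <= x < d /\ a <= x < b.
  by clear -le_ac le_db le_cpd; lia.
have [[i'_d i'_b] [j'_d j'_b]] := (sub_c _ i'_c, sub_c _ j'_c).
rewrite (perp i i') // (perp j j') //.
by apply: perq; rewrite // (mod_q _ _ eq_i) (mod_q _ _ eq_j) eq_ij.
Qed.

Lemma fine_wilf f p q a b : 0 < p -> 0 < q -> a + p + q <= b.+1 ->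
  has_period f p a b -> has_period f q a b -> has_period f (gcdn p q) a b.
Proof.
have [s] := ubnP (p + q); elim: s p q b => // s IHs p q b lt_s.
wlog le_pq : p q lt_s / p <= q => [thesis|] p_gt0 q_gt0 le_b perp perq.
  case: (leqP p q) => [/thesis|/ltnW/thesis]; first exact.
  by rewrite gcdnC; apply=> //; lia.
case: (ltngtP p q) le_pq => // [lt_pq|eq_pq] _; last by rewrite -eq_pq gcdnn.
have per_sub : has_period f (q - p) a (b - p).
  apply/has_periodP; first by lia.
  move=> i le_ai lt_i; have /has_periodP step_p := perp.
  have /has_periodP step_q := perq.
  rewrite -step_p //; [| lia | lia].
  by rewrite -addnA subnK ?step_q //; lia.
have gcdE : gcdn p (q - p) = gcdn p q.
  by rewrite -[in RHS](subnKC (ltnW lt_pq)) gcdnDl.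
have per_gcd : has_period f (gcdn p q) a (b - p).
  rewrite -gcdE; apply: IHs => //; try lia.
  by apply: has_period_sub perp; lia.
by apply: (has_period_extend (p := p) (c := a) (d := b - p)) => //;
  rewrite ?dvdn_gcdl //; lia.
Qed.

Lemma has_period_glue f p a b c d : 0 < p -> c + p <= b ->
  has_period f p a b -> has_period f p c d -> has_period f p a d.
Proof.
move=> p_gt0 le_cb /has_periodP step1 /has_periodP step2.
apply/has_periodP => // i le_ai lt_d.
by case: (ltnP (i + p) b) => [|le_b]; [apply: step1|apply: step2]; lia.
Qed.

Definition window f i n := [seq f j | j <- iota i n].

Lemma windowE f i n : window f i n = mkseq (fun l => f (i + l)) n.
Proof. by rewrite /window -[i in iota i]addn0 iotaDl -map_comp. Qed.

Lemma windowP f g i j n :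
  window f i n = window g j n <-> forall l, l < n -> f (i + l) = g (j + l).
Proof.
rewrite !windowE; split=> [eq_w l lt_l | eq_fg].
  by have /(congr1 (nth (f 0) ^~ l)) := eq_w; rewrite !nth_mkseq.
by apply/eq_in_map => l; rewrite mem_iota => /eq_fg.
Qed.

Lemma sub_window f g i j n c k : c + k <= n ->
  window f i n = window g j n -> window f (i + c) k = window g (j + c) k.
Proof.
move=> le_ck /windowP eq_w; apply/windowP => l lt_l.
by rewrite -!addnA eq_w //; lia.
Qed.

Lemma windowS f i n : window f i n.+1 = f i :: window f i.+1 n.
Proof. by []. Qed.

Lemma windowSr f i n : window f i n.+1 = rcons (window f i n) (f (i + n)).
Proof. by rewrite /window -addn1 iotaD map_cat cats1. Qed.

Lemma perm_window_period f i p :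
  perm_eq (window f i p) (window f i.+1 p) -> f i = f (i + p).
Proof.
case: p => [|p]; first by rewrite addn0.
rewrite windowS windowSr -cats1 perm_sym perm_catC /= addSnnS.
rewrite -cat1s -[f i :: _]cat1s perm_cat2r => /perm_mem/(_ (f i)).
by rewrite !mem_seq1 eqxx => /eqP.
Qed.

Lemma period_perm_window f p b i : 0 < p ->
  has_period f p 0 b -> i + p <= b -> perm_eq (window f i p) (window f 0 p).
Proof.
move=> p_gt0 /has_periodP per; elim: i => // i IHi le_b.
apply: perm_trans (IHi _); last by lia.
have e : f (i + p) = f i by apply: per; lia.
case: p p_gt0 {per IHi} le_b e => // p _ _ e.
by rewrite windowSr windowS addSnnS e perm_rcons.
Qed.

Section Windows.
Variable n : nat.

Definition windows_sub m f g :=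
  forall i, i < m -> exists2 j, j < m & window f i n = window g j n.

(* Counting letters in the windows of length [p], rather than comparing
   overlapping windows of length [n], also covers the case [p = n]. *)
Lemma period_transfer m f g p : 0 < p <= n -> 0 < m -> windows_sub m f g ->
  has_period g p 0 (n + m).-1 -> has_period f p 0 (n + m).-1.
Proof.
case/andP=> p_gt0 le_pn m_gt0 sub_fg per_g.
have perm_f i : i + p <= (n + m).-1 ->
    perm_eq (window f i p) (window g 0 p).
  move=> le_i; have [j lt_j eq_w] := sub_fg (minn i m.-1) ltac:(lia).
  have {1}-> : i = minn i m.-1 + (i - m.-1) by lia.
  rewrite (sub_window _ eq_w); last by lia.
  by apply: period_perm_window per_g _ => //; lia.
apply/has_periodP => // i _ lt_i; symmetry; apply: perm_window_period.
apply: perm_trans (perm_f i _) _; first by lia.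
by rewrite perm_sym perm_f //; lia.
Qed.

Definition rigid m := forall f g, windows_sub m f g -> windows_sub m g f ->
  (forall i, i < (n + m).-1 -> f i = g i) \/
  exists2 p, 0 < p <= m & has_period g p 0 (n + m).-1.

Lemma rigid_unique_prefix m f g : 0 < n -> m < n -> (0 < m -> rigid m) ->
  windows_sub m.+1 f g -> windows_sub m.+1 g f ->
  (forall p, 0 < p <= m.+1 -> window g p n.-1 <> window g 0 n.-1) ->
  forall i, i < n + m -> f i = g i.
Proof.
move=> n_gt0 lt_mn rigid_m sub_fg sub_gf uniq_g.
have start j : j < m.+1 -> window f j n = window g 0 n -> j = 0.
  case: j => // j lt_j eq_w; have [i lt_i eq_j] := sub_fg j (ltnW lt_j).
  case: (uniq_g i.+1); first by lia.
  have := sub_window (c := 1) (k := n.-1) _ eq_j; rewrite !addn1 => <-; last lia.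
  have := sub_window (c := 0) (k := n.-1) _ eq_w; rewrite !addn0 => <- //; lia.
have eq_0 : window f 0 n = window g 0 n.
  by have [j lt_j eq_j] := sub_gf 0 isT; rewrite eq_j (start j).
have eq_n i : i < n -> f i = g i by move/windowP: eq_0 => /(_ i).
pose f1 i := f i.+1; pose g1 i := g i.+1.
have win1 h i : window (fun i => h i.+1) i n = window h i.+1 n :> seq T.
  by apply/windowP => l _; rewrite addSn.
have sub1 : windows_sub m f1 g1.
  move=> i lt_i; have [[|j] lt_j eq_w] := sub_fg i.+1 lt_i.
    by have := start i.+1 lt_i eq_w.
  by exists j; rewrite ?win1.
have sub2 : windows_sub m g1 f1.
  move=> i lt_i; have [[|j] lt_j eq_w] := sub_gf i.+1 lt_i.
    case: (uniq_g i.+1); first by lia.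
    have := sub_window (c := 0) (k := n.-1) _ (etrans eq_w eq_0).
    by rewrite !addn0; apply; lia.
  by exists j; rewrite ?win1.
case=> [|i] lt_i; first exact: eq_n.
case: (posnP m) => [m0|m_gt0]; first by apply: eq_n; lia.
have [eq_fg|[p lt_p per_g]] := rigid_m m_gt0 f1 g1 sub1 sub2.
  by apply: eq_fg; lia.
have per_f : has_period f1 p 0 (n + m).-1.
  by apply: period_transfer sub1 per_g => //; lia.
have p_gt0 : 0 < p by lia.
have [j /= lt_j eq_j] := residue_in_interval 0 i p_gt0.
have j_lt : j < n.-1 by clear -lt_j lt_p lt_mn; lia.
have j_b : 0 <= j < (n + m).-1 by clear -j_lt; lia.
have i_b : 0 <= i < (n + m).-1 by clear -lt_i; lia.
rewrite -[f _]/(f1 i) -[g _]/(g1 i) -(per_f j i) // -(per_g j i) //.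
by apply: eq_n; clear -j_lt; lia.
Qed.

Lemma window_rev f m i : 0 < n -> i < m ->
  window (fun j => f ((n + m).-2 - j)) i n = rev (window f (m.-1 - i) n).
Proof.
move=> n_gt0 lt_i; rewrite !windowE; apply: (@eq_from_nth _ (f 0)).
  by rewrite size_rev !size_mkseq.
move=> l; rewrite size_mkseq => lt_l.
rewrite nth_rev ?size_mkseq // !nth_mkseq //; last by lia.
by congr f; lia.
Qed.

Lemma windows_sub_rev m f g : 0 < n -> windows_sub m f g ->
  windows_sub m (fun j => f ((n + m).-2 - j)) (fun j => g ((n + m).-2 - j)).
Proof.
move=> n_gt0 sub_fg i lt_i; have [j lt_j eq_w] := sub_fg (m.-1 - i) ltac:(lia).
exists (m.-1 - j); first by lia.
rewrite !window_rev ?eq_w; try lia.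
by congr (rev (window g _ n)); lia.
Qed.

Lemma window_border_period g p k : 0 < p -> window g p k = window g 0 k ->
  has_period g p 0 (p + k).
Proof.
move=> p_gt0 /windowP eq_w; apply/has_periodP => // i _ lt_i.
by rewrite addnC eq_w //; lia.
Qed.

Lemma has_period_rev g p s L : 0 < p -> s <= L ->
  has_period (fun j => g (L.-1 - j)) p 0 s -> has_period g p (L - s) L.
Proof.
move=> p_gt0 le_sL /has_periodP per; apply/has_periodP => // i le_i lt_i.
have := per p_gt0 (L.-1 - (i + p)) isT ltac:(lia).
have -> : L.-1 - (L.-1 - (i + p) + p) = i by lia.
by have -> : L.-1 - (L.-1 - (i + p)) = i + p by lia.
Qed.

Lemma rigidity_step m : m < n -> (0 < m -> rigid m) -> rigid m.+1.
Proof.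
move=> lt_mn IHm f g sub_fg sub_gf; have n_gt0 : 0 < n by lia.
pose rv (h : nat -> T) j := h ((n + m.+1).-2 - j).
pose repeat (h : nat -> T) :=
  has (fun p => window h p n.-1 == window h 0 n.-1) (iota 1 m.+1).
have no_repeat h : ~~ repeat h ->
    forall p, 0 < p <= m.+1 -> window h p n.-1 <> window h 0 n.-1.
  move=> /hasPn no_rep p lt_p; apply/eqP/no_rep.
  by rewrite mem_iota; lia.
have [rep_g|/no_repeat uniq_g] := boolP (repeat g); last first.
  left=> i lt_i; apply: (rigid_unique_prefix _ lt_mn IHm) uniq_g _ _ => //.
  by lia.
have [rep_g'|/no_repeat uniq_g] := boolP (repeat (rv g)); last first.
  left=> i lt_i; pose i' := (n + m).-1 - i.
  have := rigid_unique_prefix n_gt0 lt_mn IHm (windows_sub_rev n_gt0 sub_fg)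
    (windows_sub_rev n_gt0 sub_gf) uniq_g (i := i') ltac:(lia).
  by have -> : (n + m.+1).-2 - i' = i by lia.
right; case/hasP: rep_g => p; rewrite mem_iota => p_m /eqP rep_p.
have p_gt0 : 0 < p by lia.
have per_p := window_border_period p_gt0 rep_p.
case/hasP: rep_g' => q; rewrite mem_iota => q_m /eqP rep_q.
have q_gt0 : 0 < q by lia.
have per_rv := window_border_period q_gt0 rep_q.
have per_q : has_period g q (n + m - (q + n.-1)) (n + m).
  move: per_rv; rewrite /rv addnS; apply: has_period_rev; lia.
have per_g : has_period g (gcdn p q) (n + m - (q + n.-1)) (p + n.-1).
  apply: fine_wilf; try lia.
    by apply: has_period_sub per_p; lia.
  by apply: has_period_sub per_q; lia.
have gcd_gt0 : 0 < gcdn p q by rewrite gcdn_gt0; lia.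
have gcd_p : gcdn p q <= p by rewrite dvdn_leq ?dvdn_gcdl //; lia.
have gcd_q : gcdn p q <= q by rewrite dvdn_leq ?dvdn_gcdr //; lia.
have gcdp := dvdn_gcdl p q; have gcdq := dvdn_gcdr p q.
exists (gcdn p q); first by clear -p_m gcd_p gcd_gt0; lia.
rewrite addnS /=.
have per_l : has_period g (gcdn p q) 0 (p + n.-1).
  by apply: has_period_extend gcdp _ _ _ per_p per_g => //;
    clear -p_m q_m lt_mn; lia.
have per_r : has_period g (gcdn p q) (n + m - (q + n.-1)) (n + m).
  by apply: has_period_extend gcdq _ _ _ per_q per_g => //;
    clear -p_m q_m lt_mn; lia.
by apply: has_period_glue per_l per_r => //; clear -p_m q_m gcd_q lt_mn; lia.
Qed.

Lemma rigidity m : 0 < m <= n -> rigid m.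
Proof.
case: m => // m; elim: m => [|m IHm] /= lt_mn; apply: rigidity_step => //.
by move=> _; apply: IHm; lia.
Qed.
End Windows.
End Periods.

Section Words.
Variables (A : finType) (x0 : A) (t : nat).
Implicit Types w v : t.-tuple A.

Lemma size_window (f : nat -> A) i n : size (window f i n) = n.
Proof. by rewrite size_map size_iota. Qed.

Lemma mem_factorsP n w (u : n.-tuple A) : n <= t ->
  reflect (exists2 i, i < t - n + 1 & window (nth x0 w) i n = u)
          (u \in factors n w).
Proof.
move=> le_nt; rewrite inE; apply: (iffP idP) => [/infixP[s [s' def_w]] | ].
  have size_w : size s + (n + size s') = t.
    by rewrite -(size_tuple w) def_w !size_cat size_tuple.
  exists (size s); first by lia.
  rewrite /window map_nth_iota; last by rewrite size_tuple; lia.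
  by rewrite def_w drop_size_cat // take_size_cat ?size_tuple.
move=> [i lt_i]; rewrite /window map_nth_iota; last by rewrite size_tuple; lia.
by move=> <-; apply/infixP; exists (take i w), (drop n (drop i w));
  rewrite !cat_take_drop.
Qed.

Lemma factors_eqP n w v : n <= t ->
  factors n w = factors n v <->
  windows_sub n (t - n + 1) (nth x0 w) (nth x0 v) /\
  windows_sub n (t - n + 1) (nth x0 v) (nth x0 w).
Proof.
move=> le_nt; split=> [eq_wv | [sub_wv sub_vw]].
  have sub w' v' : factors n w' = factors n v' ->
      windows_sub n (t - n + 1) (nth x0 w') (nth x0 v').
    move=> eq_w i lt_i.
    have size_u := introT eqP (size_window (nth x0 w') i n).
    have : Tuple size_u \in factors n v'.
      by rewrite -eq_w; apply/mem_factorsP => //; exists i.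
    by case/mem_factorsP=> // j lt_j eq_j; exists j; rewrite // eq_j.
  by split; apply: sub.
apply/setP=> u.
apply/(mem_factorsP _ _ le_nt)/(mem_factorsP _ _ le_nt) => -[i lt_i <-].
  by have [j lt_j eq_j] := sub_wv i lt_i; exists j.
by have [j lt_j eq_j] := sub_vw i lt_i; exists j.
Qed.

Definition periodic w p :=
  [forall i : 'I_t, nth x0 w i == nth x0 w (i %% p)].

Lemma periodicP w p : 0 < p ->
  reflect (has_period (nth x0 w) p 0 t) (periodic w p).
Proof.
move=> p_gt0; apply: (iffP forallP) => [per i j lt_i lt_j eq_ij | per i].
  by rewrite (eqP (per (Ordinal lt_i))) (eqP (per (Ordinal lt_j))) /= eq_ij.
apply/eqP/per; rewrite ?modn_mod //=.
exact: leq_ltn_trans (leq_mod _ _) (ltn_ord i).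
Qed.

Lemma periodic_exists w : exists p, (0 < p) && periodic w p.
Proof.
by exists t.+1; apply/forallP => i; rewrite modn_small // ltnS ltnW.
Qed.

Definition min_period w := ex_minn (periodic_exists w).

Lemma min_periodP w :
  [/\ 0 < min_period w, has_period (nth x0 w) (min_period w) 0 t
    & forall p, 0 < p -> has_period (nth x0 w) p 0 t -> min_period w <= p].
Proof.
rewrite /min_period; case: ex_minnP => p /andP[p_gt0 /periodicP per] min_p.
split=> // [|q q_gt0 per_q]; first exact: per.
by apply: min_p; rewrite q_gt0; apply/periodicP.
Qed.

Lemma periodic_min_period w k : 0 < k -> k + k <= t.+1 ->
  periodic w k = (min_period w %| k).
Proof.
move=> k_gt0 le_k; have [d_gt0 per_d min_d] := min_periodP w.
apply/periodicP/idP => // [per_k | /dvdnP[q def_k] i j lt_i lt_j eq_ij].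
  have le_d := min_d k k_gt0 per_k.
  have /(min_d _ _) : has_period (nth x0 w) (gcdn (min_period w) k) 0 t.
    by apply: fine_wilf => //; lia.
  rewrite gcdn_gt0 d_gt0 => /(_ isT) le_gcd; apply/gcdn_idPl/eqP.
  by rewrite eqn_leq le_gcd dvdn_leq ?dvdn_gcdl.
apply: per_d => //; have dvd_k : min_period w %| k by rewrite def_k dvdn_mull.
by rewrite -(modn_dvdm i dvd_k) eq_ij modn_dvdm.
Qed.

Definition extension k (u : k.-tuple A) : t.-tuple A :=
  [tuple nth x0 u (i %% k) | i < t].

Lemma nth_extension k (u : k.-tuple A) i :
  i < t -> nth x0 (extension u) i = nth x0 u (i %% k).
Proof.
by move=> lt_i; rewrite -[i]/(val (Ordinal lt_i)) -tnth_nth tnth_mktuple.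
Qed.

Lemma card_periodic k : 0 < k <= t -> #|[set w | periodic w k]| = #|A| ^ k.
Proof.
case/andP=> k_gt0 le_kt; rewrite -card_tuple -(card_imset _ (f := @extension k)).
  apply: eq_card => w; rewrite inE; apply/forallP/imsetP => [per | [u _ ->] i].
    exists [tuple nth x0 w i | i < k] => //.
    apply: eq_from_tnth => i; rewrite !(tnth_nth x0) nth_extension //.
    rewrite (eqP (per i)) -[_ %% k in RHS]/(val (Ordinal (ltn_pmod i k_gt0))).
    by rewrite -tnth_nth tnth_mktuple.
  rewrite !nth_extension ?modn_mod //.
  exact: leq_ltn_trans (leq_mod _ _) (ltn_ord i).
move=> u v eq_uv; apply: eq_from_tnth => i; rewrite !(tnth_nth x0).
have := congr1 (fun w : t.-tuple A => nth x0 w i) eq_uv.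
by rewrite !nth_extension ?modn_small //; have := ltn_ord i; lia.
Qed.

Definition rotation w k i : t.-tuple A :=
  [tuple nth x0 w ((l + i) %% k) | l < t].

Lemma nth_rotation w k i l :
  l < t -> nth x0 (rotation w k i) l = nth x0 w ((l + i) %% k).
Proof.
by move=> lt_l; rewrite -[l]/(val (Ordinal lt_l)) -tnth_nth tnth_mktuple.
Qed.

Variable n : nat.
Hypotheses (n_gt0 : 0 < n) (le_nt : n <= t) (lt_t2n : t < 2 * n).
Let t_eq : (n + (t - n + 1)).-1 = t. Proof. lia. Qed.

Lemma same_factors_period w v k : 0 < k <= n -> factors n w = factors n v ->
  has_period (nth x0 v) k 0 t -> has_period (nth x0 w) k 0 t.
Proof.
move=> k_n /factors_eqP[] // sub_wv _.
have := @period_transfer _ n (t - n + 1) (nth x0 w) (nth x0 v) k.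
by rewrite t_eq; apply; rewrite // addn1.
Qed.

Lemma class_long_period w : t - n + 1 < min_period w ->
  [set v : t.-tuple A | factors n v == factors n w] = [set w].
Proof.
move=> lt_m; apply/setP=> v; rewrite !inE; apply/eqP/eqP => [|-> //].
case/factors_eqP=> // sub_vw sub_wv; have m_n : 0 < t - n + 1 <= n by lia.
have [eq_vw|[p lt_p]] := rigidity m_n sub_vw sub_wv.
  by apply: eq_from_tnth => i; rewrite !(tnth_nth x0) eq_vw // t_eq.
rewrite t_eq => per; have [_ _ min_w] := min_periodP w.
by have := min_w p _ per; lia.
Qed.

Lemma class_short_period w : min_period w <= t - n + 1 ->
  #|[set v : t.-tuple A | factors n v == factors n w]| = min_period w.
Proof.
have [] := min_periodP w; set k := min_period w => k_gt0 per_w min_k le_km.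
have red l : l < t -> nth x0 w (l %% k) = nth x0 w l.
  move=> lt_l; apply: per_w; rewrite ?modn_mod //.
  exact: leq_ltn_trans (leq_mod _ _) lt_l.
have unshift (i : 'I_k) b : exists2 a, a < k & a + i = b %[mod k].
  have [a /andP[lt_a lt_ak] eq_a] := residue_in_interval i b k_gt0.
  by exists (a - i); [lia | rewrite subnK].
pose rot_w (i : 'I_k) := rotation w k i.
have rot_inj : injective rot_w.
  suff no_lt (i j : 'I_k) : i < j -> rot_w i <> rot_w j.
    move=> i j eq_ij; apply/val_inj; case: (ltngtP i j) => // lt_ij.
      by case: (no_lt _ _ lt_ij).
    by case: (no_lt _ _ lt_ij).
  move=> lt_ij eq_ij; have lt_jk := ltn_ord j.
  suff /min_k : has_period (nth x0 w) (j - i) 0 t by lia.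
  apply/has_periodP; first by lia.
  move=> l _ lt_l; have [a lt_ak eq_a] := unshift i l.
  have := congr1 (fun v : t.-tuple A => nth x0 v a) eq_ij.
  rewrite !nth_rotation; try lia.
  rewrite eq_a red; last by lia.
  move=> ->; rewrite -red //; congr nth.
  by rewrite -[in RHS](subnKC (ltnW lt_ij)) addnA -[in RHS]modnDml eq_a modnDml.
rewrite -[RHS]card_ord -(card_imset _ rot_inj); apply: eq_card => v.
rewrite inE; apply/eqP/imsetP => [eq_vw | [i _ ->]].
  have per_v : has_period (nth x0 v) k 0 t.
    by apply: same_factors_period eq_vw per_w; lia.
  have m_gt0 : 0 < t - n + 1 by rewrite addn1.
  case/factors_eqP: eq_vw => // /(_ 0 m_gt0) [b lt_b /windowP eq_w] _.
  exists (Ordinal (ltn_pmod b k_gt0)) => //; apply: eq_from_tnth => l.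
  rewrite !(tnth_nth x0) nth_rotation //= modnDmr.
  have lt_lk := ltn_pmod l k_gt0.
  rewrite (per_v l (l %% k)) ?modn_mod //=; last by lia.
  rewrite -[l %% k]add0n eq_w; last by lia.
  by rewrite -red ?modnDmr 1?addnC //; lia.
apply/factors_eqP => //; split=> a lt_a.
  have lt_b := ltn_pmod (a + i) k_gt0; exists ((a + i) %% k); first by lia.
  apply/windowP => l lt_l; rewrite nth_rotation; last by lia.
  rewrite -[RHS]red; last by lia.
  by rewrite modnDml addnAC.
have [b lt_b eq_b] := unshift i a; exists b; first by lia.
apply/windowP => l lt_l; rewrite nth_rotation; last by lia.
by rewrite addnAC -modnDml eq_b modnDml red //; lia.
Qed.
End Words.

Lemma squarefreeP n : 0 < n ->
  reflect (forall p, prime p -> ~~ (p ^ 2 %| n)) (squarefree n).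
Proof.
move=> n_gt0; rewrite /squarefree n_gt0; apply: (iffP allP) => sqf p.
  move=> p_pr; apply/negP => dvd_p; have: p \in primes n.
    by rewrite mem_primes p_pr n_gt0 (dvdn_trans _ dvd_p) ?dvdn_exp.
  by move/sqf; rewrite dvd_p.
by rewrite mem_primes => /andP[/sqf].
Qed.

Lemma mobius_square p n : prime p -> p ^ 2 %| n -> mobius n = 0%R.
Proof.
move=> p_pr dvd_n; rewrite /mobius; case: ifP => // sqf.
have n_gt0 : 0 < n by case/andP: sqf.
by case: (squarefreeP n_gt0) sqf => // /(_ p p_pr); rewrite dvd_n.
Qed.

Lemma mobius_prime_mul p n : prime p -> 0 < n -> ~~ (p %| n) ->
  mobius (p * n) = (- mobius n)%R.
Proof.
move=> p_pr n_gt0 ndvd_p; have p_gt0 := prime_gt0 p_pr.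
have pn_gt0 : 0 < p * n by rewrite muln_gt0 p_gt0.
have -> : mobius (p * n) =
    if squarefree n then ((-1) ^+ (size (primes n)).+1)%R else 0%R.
  rewrite /mobius; have -> : squarefree (p * n) = squarefree n.
    apply/squarefreeP/squarefreeP => // sqf q q_pr.
      by apply: contra (sqf q q_pr) => /dvdn_mull.
    have [-> | neq_qp] := eqVneq q p; first by rewrite dvdn_pmul2l.
    rewrite Gauss_dvdr ?sqf // coprimeXl // prime_coprime // dvdn_prime2 //.
  suff /perm_size -> : perm_eq (primes (p * n)) (p :: primes n) by [].
  apply: uniq_perm; rewrite ?primes_uniq //=.
    by rewrite primes_uniq mem_primes (negPf ndvd_p) !andbF.
  by move=> q; rewrite primesM // primes_prime // inE orbC in_cons orbC.
by rewrite /mobius; case: squarefree; rewrite ?oppr0 // exprS mulN1r.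
Qed.

Lemma sum_mobius n : 0 < n ->
  (\sum_(d <- divisors n) mobius d)%R = (n == 1)%:R%R.
Proof.
move=> n_gt0; have [-> | n_neq1] := eqVneq n 1.
  by rewrite (_ : divisors 1 = [:: 1]) // big_seq1.
have n_gt1 : 1 < n by lia.
have p_pr := pdiv_prime n_gt1; set p := pdiv n in p_pr.
have p_gt0 := prime_gt0 p_pr.
have /dvdnP[n' def_n] := pdiv_dvd n; rewrite -/p mulnC in def_n.
have n'_gt0 : 0 < n' by move: n_gt0; rewrite def_n muln_gt0 p_gt0.
have perm_ndvd : perm_eq [seq d <- divisors n | ~~ (p %| d)]
                         [seq d <- divisors n' | ~~ (p %| d)].
  apply: uniq_perm; rewrite ?filter_uniq ?divisors_uniq // => d.
  rewrite !mem_filter -!dvdn_divisors // def_n; case: (boolP (p %| d)) => //= ndvd.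
  by rewrite Gauss_dvdr // coprime_sym prime_coprime.
have perm_dvd : perm_eq [seq d <- divisors n | p %| d]
                        [seq p * e | e <- divisors n'].
  apply: uniq_perm; rewrite ?filter_uniq ?divisors_uniq //.
    rewrite map_inj_uniq ?divisors_uniq // => x y /eqP.
    by rewrite eqn_pmul2l // => /eqP.
  move=> d; rewrite mem_filter -dvdn_divisors // def_n.
  apply/andP/mapP => [[/dvdnP[e ->]] | [e e_n' ->]].
    rewrite mulnC dvdn_pmul2l // => dvd_e; exists e => //.
    by rewrite -dvdn_divisors.
  by rewrite dvdn_mulr // dvdn_pmul2l // dvdn_divisors.
rewrite (bigID (fun d => p %| d)) /= -big_filter (perm_big _ perm_dvd) big_map.
rewrite -[X in (_ + X)%R]big_filter (perm_big _ perm_ndvd) big_filter.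
rewrite (bigID (fun d => p %| d)) /= big1 ?add0r => [|e dvd_e]; last first.
  by apply: (mobius_square p_pr); rewrite expnS expn1 dvdn_pmul2l.
rewrite -big_split /= big_seq_cond big1 // => e /andP[e_n' ndvd_e].
rewrite mobius_prime_mul ?addNr //; move: e_n'; rewrite -dvdn_divisors //.
exact: dvdn_gt0.
Qed.

Lemma divn_divn d k : 0 < k -> d %| k -> k %/ (k %/ d) = d.
Proof. by move=> k_gt0 dvd_d; rewrite divnA // mulKn. Qed.

Lemma mobius_inversion (R : comNzRingType) (N F : nat -> R) k : 0 < k ->
  (forall d, d %| k -> F d = (\sum_(e <- divisors d) N e)%R) ->
  N k = (\sum_(d <- divisors k) (mobius (k %/ d))%:~R * F d)%R.
Proof.
move=> k_gt0 F_sum; apply/esym.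
pose mu d : R := ((mobius (k %/ d))%:~R)%R.
transitivity (\sum_(d <- divisors k) \sum_(e <- divisors k)
    if (e %| d)%N then mu d * N e else 0)%R.
  apply: eq_big_seq => d; rewrite -dvdn_divisors // => dvd_d.
  have d_gt0 := dvdn_gt0 k_gt0 dvd_d.
  rewrite F_sum // big_distrr -big_mkcond -[RHS]big_filter /=.
  apply: perm_big; apply: uniq_perm; rewrite ?filter_uniq ?divisors_uniq // => e.
  rewrite mem_filter -!dvdn_divisors //.
  by case: (boolP (e %| d)) => //= /dvdn_trans->.
rewrite exchange_big /= (bigD1_seq k) ?divisors_uniq ?divisors_id //=.
have sum_mu e : e %| k ->
    (\sum_(d <- divisors k) (if (e %| d)%N then mu d * N e else 0))%R =
    (((k %/ e)%N == 1)%:R * N e)%R.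
  move=> dvd_e; have e_gt0 := dvdn_gt0 k_gt0 dvd_e.
  have ke_gt0 : 0 < k %/ e by rewrite divn_gt0 // dvdn_leq.
  rewrite -big_mkcond -big_distrl -big_filter /=; congr (_ * _)%R.
  have perm_d : perm_eq [seq d <- divisors k | e %| d]
                        [seq k %/ c | c <- divisors (k %/ e)].
    have dvd_k c : c %| k %/ e -> c %| k.
      by move/dvdn_trans; apply; apply: dvdn_div.
    apply: uniq_perm; rewrite ?filter_uniq ?divisors_uniq //.
      rewrite map_inj_in_uniq ?divisors_uniq // => x y.
      rewrite -!dvdn_divisors // => /dvd_k dvd_x /dvd_k dvd_y eq_xy.
      by rewrite -(divn_divn k_gt0 dvd_x) eq_xy divn_divn.
    move=> d; rewrite mem_filter -dvdn_divisors //.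
    apply/andP/mapP => [[dvd_ed dvd_d] | [c]].
      exists (k %/ d); last by rewrite divn_divn.
      rewrite -dvdn_divisors // dvdn_divRL //.
      by rewrite -[X in _ %| X](divnK dvd_d) dvdn_mul.
    rewrite -dvdn_divisors // => dvd_c ->; have dvd_ck := dvd_k _ dvd_c.
    by rewrite dvdn_div // dvdn_divRL // mulnC -dvdn_divRL.
  transitivity ((\sum_(c <- divisors (k %/ e)) mobius c)%:~R : R)%R; last first.
    by rewrite sum_mobius // rmorph_nat.
  rewrite (perm_big _ perm_d) big_map rmorph_sum /=.
  apply: eq_big_seq => c; rewrite -dvdn_divisors // => dvd_c.
  by rewrite /mu divn_divn // (dvdn_trans dvd_c (dvdn_div dvd_e)).
rewrite sum_mu // divnn k_gt0 mul1r big_seq_cond big1 ?addr0 // => e.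
rewrite -dvdn_divisors // => /andP[dvd_e neq_e].
rewrite sum_mu //; case: eqP => [eq1|_]; last by rewrite mul0r.
by case/eqP: neq_e; rewrite -[LHS](divn_divn k_gt0 dvd_e) eq1 divn1.
Qed.

Section Counting.
Variables (n t : nat).
Hypotheses (n_gt0 : 0 < n) (le_nt : n <= t) (lt_t2n : t < 2 * n).
Local Notation word := (t.-tuple bool).
Local Notation mp := (@min_period _ false t).

Lemma card_periodic_sum d : 0 < d <= t - n + 1 ->
  2 ^ d = \sum_(e <- divisors d) #|[set w : word | mp w == e]|.
Proof.
case/andP=> d_gt0 le_d.
rewrite -[in LHS]card_bool -(card_periodic false (t := t)); last by lia.
under eq_bigr do rewrite -sum1dep_card big_mkcond.
rewrite exchange_big /= -sum1dep_card big_mkcond /=; apply: eq_bigr => w _.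
rewrite -big_mkcond sum1_count periodic_min_period //; last by lia.
rewrite (eq_count (a2 := pred1 (mp w))) => [|e]; last exact: eq_sym.
by rewrite count_uniq_mem ?divisors_uniq // -dvdn_divisors //; case: (_ %| _).
Qed.

Local Open Scope ring_scope.

Lemma card_min_period k : (0 < k <= t - n + 1)%N ->
  #|[set w : word | mp w == k]|%:R =
  \sum_(d <- divisors k) (mobius (k %/ d)%N)%:~R * 2%:R ^+ d :> rat.
Proof.
case/andP=> k_gt0 le_k.
apply: (mobius_inversion (N := fun k => #|[set w : word | mp w == k]|%:R)
  (F := fun d => 2%:R ^+ d)) => // d dvd_d.
rewrite -natrX card_periodic_sum ?natr_sum //.
by rewrite (dvdn_gt0 k_gt0 dvd_d) (leq_trans (dvdn_leq k_gt0 dvd_d)).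
Qed.

Lemma num_factor_sets_sum :
  (num_factor_sets t n)%:R =
  \sum_(w : word) (#|[set v : word | factors n v == factors n w]|%:R)^-1 :> rat.
Proof.
have -> : num_factor_sets t n = #|[set factors n w | w : word in setT]|.
  apply: eq_card => S; rewrite inE; apply/existsP/imsetP.
    by case=> w /eqP->; exists w.
  by case=> w _ ->; exists w.
under eq_bigl => w do rewrite -(in_setT w).
rewrite (partition_big_imset (fun w : word => factors n w)) /=.
rewrite -sum1_card natr_sum; apply: eq_bigr => _ /imsetP[w _ ->].
under eq_bigl => v do rewrite in_setT /=.
under eq_bigr => v /eqP-> do [].
rewrite sumr_const; set c := #|_ : {set _}|.
have -> : #|[pred v : word | factors n v == factors n w]| = c.
  by apply: eq_card => v; rewrite !inE.
rewrite -[RHS]mulr_natr mulVf // pnatr_eq0 -lt0n card_gt0.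
by apply/set0Pn; exists w; rewrite inE.
Qed.

Lemma class_weight (w : word) :
  (#|[set v : word | factors n v == factors n w]|%:R)^-1 =
  1 - \sum_(1 <= k < (t - n + 1).+1) (mp w == k)%:R * ((k%:R - 1) / k%:R) :> rat.
Proof.
have [mp_gt0 _ _] := min_periodP false w.
have neq0 : (mp w)%:R != 0 :> rat by rewrite pnatr_eq0 -lt0n.
case: (leqP (mp w) (t - n + 1)) => [le_m | lt_m]; last first.
  rewrite (class_long_period n_gt0 le_nt lt_t2n lt_m) cards1 invr1.
  rewrite big_nat_cond big1 ?subr0 // => k /andP[/andP[_ lt_k] _].
  by case: eqP => [eq_k|_]; [move: lt_m; rewrite eq_k; lia | rewrite mul0r].
rewrite (class_short_period n_gt0 le_nt lt_t2n le_m).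
rewrite (bigD1_seq (mp w)) ?iota_uniq ?mem_index_iota ?mp_gt0 //= eqxx mul1r.
rewrite big1 => [|k]; first by field.
by rewrite eq_sym => /negPf->; rewrite mul0r.
Qed.
End Counting.

Local Open Scope ring_scope.

Theorem corollary19 (n t : nat) (hn : (0 < n)%N) (ht : (0 < t)%N)
    (hnt : (n <= t)%N) (ht2n : (t < 2 * n)%N) :
  (num_factor_sets t n)%:R =
    2%:R ^+ t -
    \sum_(1 <= k < (t - n + 1).+1)
      (k%:R - 1) / k%:R *
      \sum_(d <- divisors k) (mobius (k %/ d)%N)%:~R * 2%:R ^+ d :> rat.
Proof.
rewrite num_factor_sets_sum.
under eq_bigr do rewrite class_weight //.
rewrite sumrB sumr_const card_tuple card_bool natrX; congr (_ - _).
rewrite exchange_big /=; apply: eq_big_nat => k k_m.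
rewrite -(card_min_period hn hnt ht2n k_m) -big_distrl [RHS]mulrC /=.
congr (_ * _).
by rewrite -natr_sum -sum1dep_card [in RHS]big_mkcond /=.
Qed.
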